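(* Let $n>10^{(10^{13})}$ be an integer with factorization $n=\prod_{i=1}^r p_i^{a_i}$, where $p_i$ is the $i$-th prime, $a_i\ge 0$, and $p_r$ is the largest prime divisor of $n$. For integers $k\ge1$ put $x_k=(k\log n)^{1/k}$, and for a prime $p$ with $x_{k+1}<p\le x_k$ for some integer $k\ge 1$ define $U_n(p)=\left\lfloor \frac{\log(k\log n)}{\log p}\right\rfloor$. Let $G(m)=\frac{\sigma(m)}{m\log\log m}$. Suppose that for some index $s$, $U_n(p_s)$ is defined and $a_s>U_n(p_s)$. Then $G(n)<G(n/p_s)$. Consequently, if $n$ is the least counterexample to Robin's inequality (the least integer $n>5040$ with $\sigma(n)\ge e^\gamma n\log\log n$), then $a_i\le U_n(p_i)$ for all $1\le i\le r$.
   Context: $\sigma(m)=\sum_{d\mid m} d$, $\gamma$ is the Euler–Mascheroni constant, $\log$ is the natural logarithm. *)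

(* Defs.v *)
From Stdlib Require Import Reals.
From Coquelicot Require Import Coquelicot.
From mathcomp Require Import all_boot.
Set Implicit Arguments. Unset Strict Implicit.
Open Scope R_scope.

Definition sigma (m : nat) : nat := (\sum_(d <- divisors m) d)%N.

Definition G (m : nat) : R := INR (sigma m) / (INR m * ln (ln (INR m))).

Definition xk (n k : nat) : R := Rpower (INR k * ln (INR n)) (/ INR k).

(* U_n(p) = floor( log(k log n) / log p ), for the k with x_{k+1} < p <= x_k *)
Definition Uval (n k p : nat) : Z :=
  Int_part (ln (INR k * ln (INR n)) / ln (INR p)).

Definition euler_gamma : R :=
  real (Lim_seq (fun N : nat =>
          sum_f_R0 (fun j => / INR (j + 1)) N - ln (INR (N + 1)))).

Definition robin_counterexample (m : nat) : Prop :=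
  (5040 < m)%N /\ INR (sigma m) >= exp euler_gamma * INR m * ln (ln (INR m)).

(* Main.v *)
From Stdlib Require Import Reals Lra Lia.
From Coquelicot Require Import Rcomplements.
From mathcomp Require Import all_boot.
Require Import Defs.

(* Write a = v_p(n) and let x_{k+1} < p <= x_k.  From p <= x_k we get k <= U_n(p) < a,
   and from x_{k+1} < p we get p^(k+1) > (k+1) log n; together p^a log p > log n log log n.
   Splitting the divisors of n according to whether p divides them gives
   sigma(n) p^(a-1) <= sigma(n/p) (p^a + 1), so removing one factor p multiplies sigma(m)/m
   by at least 1/(1 + p^-a), whereas log log m drops by at least log p / log n; the bound on
   p^a makes the second effect win, i.e. G(n) < G(n/p).  If n is a least counterexample to
   Robin's inequality, n/p (still > 5040, as p^2 | n) would then be a smaller one. *)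

Set Implicit Arguments.
Unset Strict Implicit.

Local Open Scope nat_scope.

Lemma leq_sum_sigma (s : seq nat) (f : nat -> nat) (m : nat) :
  0 < m -> uniq s -> {in s &, injective f} -> {in s, forall x, f x %| m} ->
  \sum_(x <- s) f x <= sigma m.
Proof.
move=> m_gt0 s_uniq f_inj f_dvd.
rewrite -(big_map f predT id) /sigma.
apply: (uniq_sub_le_big leqnn (fun x y => leq_addr y x) predT) => //.
- by rewrite map_inj_in_uniq.
- exact: divisors_uniq.
- by move=> _ /mapP[x xs ->]; rewrite -dvdn_divisors // f_dvd.
Qed.

Lemma sigma_gt0 (m : nat) : 0 < m -> 0 < sigma m.
Proof.
move=> m_gt0; rewrite /sigma (bigD1_seq m) ?divisors_id ?divisors_uniq //.
by rewrite addn_gt0 m_gt0.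
Qed.

Section DivisorsModP.

Variables (n p : nat).
Hypotheses (p_prime : prime p) (n_gt0 : 0 < n) (p_dvd_n : p %| n).

Let p_gt0 : 0 < p := prime_gt0 p_prime.
Let a_gt0 : 0 < logn p n.
Proof. by rewrite logn_gt0 mem_primes p_prime n_gt0. Qed.

Lemma sum_pmultiple_divisors_le :
  \sum_(d <- divisors n | p %| d) d <= p * sigma (n %/ p).
Proof.
rewrite -big_filter.
have -> : \sum_(d <- [seq d <- divisors n | p %| d]) d
           = p * \sum_(d <- [seq d <- divisors n | p %| d]) d %/ p.
  rewrite big_distrr; apply: eq_big_seq => d; rewrite mem_filter => /andP[pd _].
  by rewrite /= mulnC divnK.
rewrite leq_mul2l; apply/orP; right; apply: leq_sum_sigma.
- by rewrite divn_gt0 // dvdn_leq.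
- by rewrite filter_uniq // divisors_uniq.
- move=> x y; rewrite !mem_filter => /andP[px _] /andP[py _] exy.
  by rewrite -(divnK px) -(divnK py) exy.
- move=> d; rewrite mem_filter => /andP[pd dn].
  by rewrite dvdn_divRL // divnK // dvdn_divisors.
Qed.

Lemma sum_coprime_divisors_le :
  (\sum_(d <- divisors n | ~~ (p %| d)) d) * p ^ (logn p n).-1 <= sigma (n %/ p).
Proof.
rewrite big_distrl -big_filter /=; apply: leq_sum_sigma.
- by rewrite divn_gt0 // dvdn_leq.
- by rewrite filter_uniq // divisors_uniq.
- by move=> x y _ _ /eqP; rewrite eqn_pmul2r ?expn_gt0 ?p_gt0 // => /eqP.
- move=> d; rewrite mem_filter => /andP[pd dn].
  rewrite dvdn_divRL // -mulnA -expnSr prednK // Gauss_dvd.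
    by rewrite pfactor_dvdnn dvdn_divisors // dn.
  by rewrite coprimeXr // coprime_sym prime_coprime.
Qed.

Lemma sigma_mul_pow_le :
  sigma n * p ^ (logn p n).-1 <= sigma (n %/ p) * (p ^ logn p n + 1).
Proof.
rewrite {1}/sigma (bigID (dvdn p)) /= mulnDl mulnDr muln1.
apply: leq_add sum_coprime_divisors_le.
rewrite -{2}(prednK a_gt0) expnS mulnA leq_mul2r.
by rewrite (mulnC (sigma _)) sum_pmultiple_divisors_le orbT.
Qed.

End DivisorsModP.

Lemma leq_sqr_divn (n p : nat) : p ^ 2 %| n -> n <= (n %/ p) ^ 2.
Proof.
case: p => [|p]; first by rewrite dvd0n => /eqP ->.
move=> p2n; have pn : p.+1 %| n by apply: dvdn_trans p2n; apply: dvdn_exp.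
rewrite -{1}(divnK pn) expnS expn1 leq_mul2l.
have [-> //|N_gt0] := posnP (n %/ p.+1); apply/orP; right.
by apply: (dvdn_leq N_gt0); rewrite dvdn_divRL // mulnn.
Qed.

Local Open Scope R_scope.

Lemma INR_expn (m a : nat) : INR (m ^ a)%N = INR m ^ a.
Proof. by elim: a => [|a IH] //=; rewrite expnS mulnE mult_INR IH. Qed.

Lemma ln_pos (x : R) : 1 < x -> 0 < ln x.
Proof. by move=> x_gt1; rewrite -ln_1; apply: ln_increasing; lra. Qed.

Lemma ln_gt1 (x : R) : exp 1 < x -> 1 < ln x.
Proof.
by move=> ex; rewrite -[X in X < _](ln_exp 1); apply: ln_increasing => //; exact: exp_pos.
Qed.

Lemma loglog_mul_gap (x q : R) : exp 1 < x -> 1 < q ->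
  ln q / ln (x * q) <= ln (ln (x * q)) - ln (ln x).
Proof.
move=> ex q_gt1.
have lnx_gt1 := ln_gt1 ex.
have lnq_pos := ln_pos q_gt1.
have e_pos := exp_pos 1.
rewrite ln_mult; [|lra|lra].
have := exp_ineq1_le (ln (ln x / (ln x + ln q))).
rewrite exp_ln ?ln_div; [|lra|lra|apply: Rdiv_lt_0_compat; lra].
have -> : ln q / (ln x + ln q) = 1 - ln x / (ln x + ln q) by field; lra.
lra.
Qed.

(* [G n < G (n %/ p)] for [s = sigma n], [S = sigma (n %/ p)], [x = n %/ p], [q = p] and
   [P = p ^ (a - 1)]. *)
Lemma Rdiv_loglog_lt (s S x q P : R) :
  exp 1 < x -> 1 < q -> 0 < P -> 0 < S ->
  s * P <= S * (q * P + 1) ->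
  ln (x * q) * ln (ln (x * q)) < q * P * ln q ->
  s / (x * q * ln (ln (x * q))) < S / (x * ln (ln x)).
Proof.
move=> ex q_gt1 P_pos S_pos sP growth.
have e_pos := exp_pos 1.
have exq : exp 1 < x * q by nra.
have gap := loglog_mul_gap ex q_gt1.
have L'_pos := ln_pos (ln_gt1 ex).
have L_pos := ln_pos (ln_gt1 exq).
have lnq_pos := ln_pos q_gt1.
have lnxq_pos : 0 < ln (x * q) by have := ln_gt1 exq; lra.
set L := ln (ln (x * q)) in gap L_pos growth *.
set L' := ln (ln x) in gap L'_pos *.
set g := ln q / ln (x * q) in gap.
have g_eq : g * ln (x * q) = ln q by rewrite /g; field; lra.
have L_lt : L < q * P * g.
  rewrite -g_eq in growth; nra.
have g_pos : 0 < g by apply: Rdiv_lt_0_compat.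
have key : (q * P + 1) * L' < q * P * L by nra.
have cross : s * L' < S * q * L.
  apply: (Rmult_lt_reg_r P) => //; nra.
apply: (Rmult_lt_reg_r (x * q * L * (x * L'))).
  repeat apply: Rmult_lt_0_compat; lra.
have -> : s / (x * q * L) * (x * q * L * (x * L')) = x * (s * L') by field; lra.
have -> : S / (x * L') * (x * q * L * (x * L')) = x * (S * q * L) by field; lra.
by apply: Rmult_lt_compat_l; lra.
Qed.

Lemma G_lt_G_divn (n p : nat) :
  (0 < logn p n)%N -> exp 1 < INR (n %/ p) ->
  ln (INR n) * ln (ln (INR n)) < INR p ^ logn p n * ln (INR p) ->
  G n < G (n %/ p).
Proof.
move=> a_gt0; have := a_gt0; rewrite logn_gt0 mem_primes => /and3P[p_prime n_gt0 p_dvd_n].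
set N := (n %/ p)%N => N_big growth.
have n_eq : INR n = INR N * INR p by rewrite -mult_INR -mulnE divnK.
have pow_eq : INR p ^ logn p n = INR p * INR p ^ (logn p n).-1.
  by rewrite -{1}(prednK a_gt0).
have sigma_le :
    INR (sigma n) * INR p ^ (logn p n).-1 <= INR (sigma N) * (INR p * INR p ^ (logn p n).-1 + 1).
  rewrite -pow_eq -!INR_expn -S_INR -!mult_INR -!mulnE.
  by apply/le_INR/leP; rewrite -addn1 sigma_mul_pow_le.
rewrite /G n_eq; apply: (Rdiv_loglog_lt (P := INR p ^ (logn p n).-1)) => //.
- by apply: (lt_INR 1); apply/ltP; apply: prime_gt1.
- by apply: pow_lt; apply: lt_0_INR; apply/ltP; apply: prime_gt0.
- by apply: lt_0_INR; apply/ltP; apply: sigma_gt0; rewrite divn_gt0 ?prime_gt0 // dvdn_leq.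
- by rewrite -n_eq -pow_eq.
Qed.

Lemma ln_xk (n k : nat) : ln (xk n k) = ln (INR k * ln (INR n)) / INR k.
Proof. by rewrite /xk /Rpower ln_exp Rmult_comm. Qed.

Lemma le_xk_ln (n k : nat) (x : R) : (0 < k)%N -> 0 < x -> x <= xk n k ->
  INR k * ln x <= ln (INR k * ln (INR n)).
Proof.
move=> k_gt0 x_pos /(ln_le _ _ x_pos); rewrite ln_xk => le_ln.
have k_pos : 0 < INR k by apply: lt_0_INR; apply/ltP.
by rewrite [INR k * ln x]Rmult_comm; apply/Rle_div_r.
Qed.

Lemma xk_lt_pow (n k : nat) (x : R) : (0 < k)%N -> 1 < INR n -> xk n k < x ->
  INR k * ln (INR n) < x ^ k.
Proof.
move=> k_gt0 n_gt1 lt_x.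
have k_pos : 0 < INR k by apply: lt_0_INR; apply/ltP.
have xk_pos : 0 < xk n k by apply: exp_pos.
have lnn_pos := ln_pos n_gt1.
apply: ln_lt_inv; [nra | apply: pow_lt; lra | rewrite ln_pow; last lra].
have := ln_increasing _ _ xk_pos lt_x; rewrite ln_xk => lt_ln.
by rewrite [INR k * ln x]Rmult_comm; apply/(Rlt_div_l _ _ _ k_pos).
Qed.

Lemma le_Uval (n k p : nat) : (0 < k)%N -> (1 < p)%N -> INR p <= xk n k ->
  (Z.of_nat k <= Uval n k p)%Z.
Proof.
move=> k_gt0 p_gt1 le_p.
have p_gt1R : 1 < INR p by apply: (lt_INR 1); apply/ltP.
have lnp_pos := ln_pos p_gt1R.
have le_k : INR k <= ln (INR k * ln (INR n)) / ln (INR p).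
  by apply/Rle_div_r => //; apply: le_xk_ln => //; lra.
have [_ Int_part_gt] := base_Int_part (ln (INR k * ln (INR n)) / ln (INR p)).
suff : (Z.of_nat k < Uval n k p + 1)%Z by lia.
by apply: lt_IZR; rewrite plus_IZR -INR_IZR_INZ /Uval; lra.
Qed.

Lemma mul_ln_lt_pow (y q : R) (j a : nat) :
  0 < y -> 1 < q -> (0 < j)%N -> (j <= a)%N ->
  INR j * y < q ^ j -> y * ln y < q ^ a * ln q.
Proof.
move=> y_pos q_gt1 j_gt0 le_ja lt_pow.
have j_ge1 : 1 <= INR j by apply: (le_INR 1); apply/leP.
have lnq_pos := ln_pos q_gt1.
have ln_lt : ln y < INR j * ln q.
  rewrite -ln_pow; last lra.
  apply: (Rle_lt_trans _ (ln (INR j * y))); first by apply: ln_le; nra.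
  by apply: ln_increasing; nra.
have pow_le : q ^ j <= q ^ a by apply: Rle_pow; [lra | apply/leP].
nra.
Qed.

Lemma ltn_logn_of_Uval_lt (n k p : nat) :
  (0 < k)%N -> (1 < p)%N -> INR p <= xk n k ->
  (Uval n k p < Z.of_nat (logn p n))%Z -> (k < logn p n)%N.
Proof.
move=> k_gt0 p_gt1 le_p lt_U; have le_U := le_Uval k_gt0 p_gt1 le_p.
by apply/ltP; lia.
Qed.

Lemma lt_divn_of_Uval_lt (n p k : nat) (c : R) :
  0 <= c -> c ^ 2 < INR n -> prime p -> (0 < k)%N -> INR p <= xk n k ->
  (Uval n k p < Z.of_nat (logn p n))%Z -> c < INR (n %/ p).
Proof.
move=> c_ge0 n_big p_prime k_gt0 le_p lt_U.
have lt_ka := ltn_logn_of_Uval_lt k_gt0 (prime_gt1 p_prime) le_p lt_U.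
have p2_dvd_n : (p ^ 2 %| n)%N.
  by apply: dvdn_trans (pfactor_dvdnn p n); apply: dvdn_exp2l; apply: leq_ltn_trans lt_ka.
have := leq_sqr_divn p2_dvd_n => /leP /le_INR; rewrite INR_expn => n_le.
have := pos_INR (n %/ p); nra.
Qed.

Lemma G_lt_G_divn_of_Uval_lt (n p k : nat) :
  exp 1 ^ 2 < INR n -> prime p -> (0 < k)%N -> xk n k.+1 < INR p <= xk n k ->
  (Uval n k p < Z.of_nat (logn p n))%Z -> G n < G (n %/ p).
Proof.
move=> n_big p_prime k_gt0 [lt_p le_p] lt_U.
have lt_ka := ltn_logn_of_Uval_lt k_gt0 (prime_gt1 p_prime) le_p lt_U.
have n_gt1 : 1 < INR n by have := exp_ineq1_le 1; nra.
have p_gt1 : 1 < INR p by apply: (lt_INR 1); apply/ltP; apply: prime_gt1.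
apply: G_lt_G_divn; first exact: leq_ltn_trans lt_ka.
  exact: (lt_divn_of_Uval_lt (Rlt_le _ _ (exp_pos 1)) n_big p_prime k_gt0 le_p lt_U).
apply: (mul_ln_lt_pow _ p_gt1 (ltn0Sn k) lt_ka).
  exact: ln_pos.
exact: xk_lt_pow.
Qed.

Lemma le_G_iff (c : R) (m : nat) : 0 < INR m * ln (ln (INR m)) ->
  c <= G m <-> c * INR m * ln (ln (INR m)) <= INR (sigma m).
Proof. by move=> pos; rewrite /G Rmult_assoc; symmetry; apply: Rle_div_r. Qed.

Lemma robin_counterexample_of_G_lt (n m : nat) :
  robin_counterexample n -> G n < G m -> (5040 < m)%N -> robin_counterexample m.
Proof.
have pos j : (5040 < j)%N -> 0 < INR j * ln (ln (INR j)).
  move=> j_big; have e_lt : exp 1 < INR j.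
    apply: (Rle_lt_trans _ (INR 3)); first by have := exp_le_3; simpl; lra.
    by apply: lt_INR; apply/ltP; exact: leq_ltn_trans j_big.
  have := ln_pos (ln_gt1 e_lt); have := exp_pos 1; nra.
move=> [n_big rob_n] lt_G m_big; split => //.
apply/Rle_ge/le_G_iff; first exact: pos.
have /le_G_iff : exp euler_gamma * INR n * ln (ln (INR n)) <= INR (sigma n) by lra.
by move=> /(_ (pos _ n_big)); lra.
Qed.

Lemma logn_le_Uval_of_minimal (n p k : nat) :
  5040 ^ 2 < INR n -> robin_counterexample n ->
  (forall m, robin_counterexample m -> (n <= m)%N) ->
  prime p -> (0 < k)%N -> xk n k.+1 < INR p <= xk n k ->
  (Z.of_nat (logn p n) <= Uval n k p)%Z.
Proof.
move=> n_big rob_n n_min p_prime k_gt0 [lt_p le_p]; apply/Z.nlt_ge => lt_U.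
have N_big : 5040 < INR (n %/ p).
  by apply: (lt_divn_of_Uval_lt _ n_big p_prime k_gt0 le_p lt_U); lra.
have N_gt : (5040 < n %/ p)%N by apply/ltP/INR_lt; rewrite INR_IZR_INZ /=.
have e2_lt : exp 1 ^ 2 < INR n by have := exp_le_3; have := exp_pos 1; nra.
have lt_G := G_lt_G_divn_of_Uval_lt e2_lt p_prime k_gt0 (conj lt_p le_p) lt_U.
have := n_min _ (robin_counterexample_of_G_lt rob_n lt_G N_gt).
case: rob_n => n_gt _; rewrite leqNgt ltn_Pdiv ?prime_gt1 //.
exact: leq_ltn_trans n_gt.
Qed.

Lemma sqr_5040_lt_pow10 : 5040 ^ 2 < 10 ^ (10 ^ 13)%N.
Proof.
apply: (Rlt_le_trans _ (10 ^ 8)); first by simpl; lra.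
apply: Rle_pow; first lra.
by apply/leP; apply: (@leq_trans 13) => //; apply: ltnW; apply: ltn_expl.
Qed.

Theorem theorem3 :
  (forall (n p k : nat),
      INR n > 10 ^ (10 ^ 13)%N ->
      prime p ->
      (1 <= k)%N ->
      xk n k.+1 < INR p <= xk n k ->
      (Z.of_nat (logn p n) > Uval n k p)%Z ->
      G n < G (n %/ p)%N)
  /\
  (forall n : nat,
      INR n > 10 ^ (10 ^ 13)%N ->
      robin_counterexample n ->
      (forall m : nat, robin_counterexample m -> (n <= m)%N) ->
      forall (p k : nat),
        prime p -> (p <= max_pdiv n)%N ->
        (1 <= k)%N ->
        xk n k.+1 < INR p <= xk n k ->
        (Z.of_nat (logn p n) <= Uval n k p)%Z).
Proof.
have big := sqr_5040_lt_pow10.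
split.
  move=> n p k n_big p_prime k_gt0 hx lt_U.
  apply: (G_lt_G_divn_of_Uval_lt _ p_prime k_gt0 hx (Z.gt_lt _ _ lt_U)).
  by have := exp_le_3; have := exp_pos 1; nra.
move=> n n_big rob_n n_min p k p_prime _ k_gt0 hx.
by apply: logn_le_Uval_of_minimal => //; lra.
Qed.
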